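(* Let $A$ be a prime commutative differential algebra (not necessarily with identity) over a field $k$ of characteristic zero. Then the Lie algebra $\mathrm{Diff}\, A$ is prime.
   Context: A differential $k$-algebra is a commutative associative $k$-algebra $A$, not necessarily with identity, equipped with a specified $k$-linear derivation $a\mapsto a'$ (an additive map with $(ab)'=ab'+a'b$ for all $a,b\in A$). A differential ideal is an ideal $I$ with $a'\in I$ for all $a\in I$. A differential algebra $A$ is prime if $I\cdot J\neq 0$ for any nonzero differential ideals $I,J$ of $A$. The Lie algebra of special derivations of $A$ is $\mathrm{Diff}\, A=\{a\partial \mid a\in A\}$ (a copy of the vector space $A$) with bracket $[a\partial,b\partial]=(ab'-a'b)\partial$. A Lie algebra $L$ is prime if $[I,J]\neq 0$ for any nonzero ideals $I,J\subset L$.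
   Formalization: The derivation of A is additionally assumed to be nonzero when A is nonzero; without this the claim fails, e.g. A = k with zero derivation is prime but Diff A is nonzero abelian, hence not prime. *)

(* Defs.v *)
From HB Require Import structures.
From mathcomp Require Import all_boot all_order all_algebra.
From mathcomp Require Import boolp classical_sets.

Set Implicit Arguments.
Unset Strict Implicit.
Unset Printing Implicit Defensive.

Import GRing.Theory.
Local Open Scope classical_set_scope.
Local Open Scope ring_scope.

Definition subspace (k : fieldType) (V : lmodType k) (S : set V) : Prop :=
  S 0 /\ forall (c : k) (u v : V), S u -> S v -> S (c *: u + v).

(* Finite sums of values of [op] on [I] x [J].  Closure under scalars need not
   be imposed: it is automatic when [I] is a subspace and [op] is bilinear. *)
Definition span_op (V : nmodType) (op : V -> V -> V) (I J : set V) : set V :=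
  [set x | exists s : seq (V * V),
     (forall p, p \in s -> I p.1 /\ J p.2) /\ x = \sum_(p <- s) op p.1 p.2].

(* The multiplication is not that of a MathComp ring, which would have a unit.
   Right distributivity and right homogeneity follow from commutativity. *)
HB.mixin Record Lmodule_isDiffAlg (k : fieldType) A of GRing.Lmodule k A := {
  dmul : A -> A -> A;
  der : A -> A;
  dmulA : associative dmul;
  dmulC : commutative dmul;
  dmulDl : left_distributive dmul +%R;
  dmulZl : forall (c : k) (a b : A), dmul (c *: a) b = c *: dmul a b;
  der_linear : linear der;
  der_leibniz : forall a b : A, der (dmul a b) = dmul a (der b) + dmul (der a) b
}.

#[short(type="diffAlgType")]
HB.structure Definition DiffAlg (k : fieldType) :=
  { A of Lmodule_isDiffAlg k A & GRing.Lmodule k A }.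

Arguments dmul {k s} : rename.
Arguments der {k s} : rename.

HB.mixin Record Lmodule_isLieAlg (k : fieldType) L of GRing.Lmodule k L := {
  lie : L -> L -> L;
  lie_linearl : forall y : L, linear (lie^~ y);
  lie_linearr : forall x : L, linear (lie x);
  liexx : forall x : L, lie x x = 0;
  lie_jacobi : forall x y z : L,
    lie x (lie y z) + lie y (lie z x) + lie z (lie x y) = 0
}.

#[short(type="lieAlgType")]
HB.structure Definition LieAlg (k : fieldType) :=
  { L of Lmodule_isLieAlg k L & GRing.Lmodule k L }.

Arguments lie {k s} : rename.

Section DiffIdeals.
Variables (k : fieldType) (A : diffAlgType k).

Definition diff_ideal (I : set A) : Prop :=
  [/\ subspace I,
      forall a x : A, I x -> I (dmul a x)
    & forall x : A, I x -> I (der x)].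

Definition diff_prime : Prop :=
  forall I J : set A, diff_ideal I -> diff_ideal J ->
    I <> [set 0] -> J <> [set 0] -> span_op dmul I J <> [set 0].

End DiffIdeals.
Arguments diff_prime {k} A.

Section LieIdeals.
Variables (k : fieldType) (L : lieAlgType k).

Definition lie_ideal (I : set L) : Prop :=
  subspace I /\ forall a x : L, I x -> I (lie a x).

Definition lie_prime : Prop :=
  forall I J : set L, lie_ideal I -> lie_ideal J ->
    I <> [set 0] -> J <> [set 0] -> span_op lie I J <> [set 0].

End LieIdeals.
Arguments lie_prime {k} L.

(* The element [a] of the copy [Diff A] of [A] stands for the symbol "a d", so
   [Diff A] does not identify elements inducing the same operator on [A]. *)
Definition Diff (k : fieldType) (A : diffAlgType k) : Type := A.

Section DiffLie.
Variables (k : fieldType) (A : diffAlgType k).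
Implicit Types a b c : A.

HB.instance Definition _ := GRing.Lmodule.on (Diff A).

Definition Diff_lie (x y : Diff A) : Diff A :=
  dmul (x : A) (der (y : A)) - dmul (der (x : A)) (y : A).

Fact dmul_linearl b : linear (dmul^~ b : A -> A).
Proof. by move=> c u v; rewrite dmulDl dmulZl. Qed.

Fact dmul_linearr a : linear (dmul a : A -> A).
Proof. by move=> c u v; rewrite !(dmulC a) dmul_linearl. Qed.

Fact dmulBr a b c : dmul a (b - c) = dmul a b - dmul a c.
Proof. by rewrite addrC -scaleN1r dmul_linearr scaleN1r addrC. Qed.

Fact derB a b : der (a - b) = der a - der b.
Proof. by rewrite addrC -scaleN1r der_linear scaleN1r addrC. Qed.

Fact Diff_lie_linearl (y : Diff A) : linear (Diff_lie^~ y).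
Proof.
move=> c u v; rewrite /Diff_lie der_linear !dmul_linearl.
by rewrite scalerBr opprD addrACA.
Qed.

Fact Diff_liexx (x : Diff A) : Diff_lie x x = 0.
Proof. by rewrite /Diff_lie dmulC subrr. Qed.

Fact Diff_lieC (x y : Diff A) : Diff_lie x y = - Diff_lie y x.
Proof. by rewrite /Diff_lie opprB dmulC (dmulC (der (x : A))). Qed.

Fact Diff_lie_linearr (x : Diff A) : linear (Diff_lie x).
Proof.
by move=> c u v; rewrite !(Diff_lieC x) Diff_lie_linearl opprD scalerN.
Qed.

Fact Diff_lie_lie a b c :
  Diff_lie a (Diff_lie b c) =
    dmul (dmul a b) (der (der c)) - dmul (dmul a (der (der b))) c
    - (dmul (dmul (der a) b) (der c) - dmul (dmul (der a) (der b)) c).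
Proof.
by rewrite /Diff_lie derB !der_leibniz addrKA !dmulBr !dmulA.
Qed.

Fact Diff_jacobi (x y z : Diff A) :
  Diff_lie x (Diff_lie y z) + Diff_lie y (Diff_lie z x)
    + Diff_lie z (Diff_lie x y) = 0.
Proof.
have cyc (V : zmodType) (P Q R : V) : P - Q + (Q - R) + (R - P) = 0.
  by rewrite !subrKA subrr.
have cancel (V : zmodType) (P Q R S T U : V) :
    P - Q - (S - T) + (R - P - (T - U)) + (Q - R - (U - S)) = 0.
  rewrite [X in X + _]addrACA -opprD addrACA -opprD cyc subr0.
  by rewrite (addrC (P - Q)) cyc.
have rot (a b c : A) : dmul (dmul a b) c = dmul (dmul b c) a.
  by rewrite -dmulA dmulC.
rewrite !Diff_lie_lie; move: (x : A) (y : A) (z : A) => a b c.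
rewrite (rot b c) (rot c a) (rot a _ c) (rot b _ a) (rot c _ b) (rot _ a b)
  (rot _ (der b) c) (rot _ (der c) a) (rot _ (der a) b).
exact: cancel.
Qed.

HB.instance Definition _ := Lmodule_isLieAlg.Build k (Diff A)
  Diff_lie_linearl Diff_lie_linearr Diff_liexx Diff_jacobi.

End DiffLie.

(* Main.v *)
(** Let [I] and [J] be Lie ideals of [Diff A] with [[I, J] = 0], and take
    [a] in [I], [b] in [J].  Expanding [[a, [x, b]] = 0] yields a relation
    [x c = x' p - x'' q] valid for all [x], where [q = a b].  Its left-hand side
    is multiplicative in [x]; comparing the values at [x y], [x] and [y] gives
    [x y c = 2 x' y' q], and comparing again at [y z] gives [x y z c = 0].
    Since annihilators of nonzero differentially closed sets vanish in a prime
    algebra, [c = 0], then [q = 0]: thus [I] annihilates [J], hence, by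
    induction, all the derivatives of [J], which contradicts primeness. *)
Require Import Defs.
From mathcomp Require Import all_boot all_order all_algebra.
From mathcomp Require Import boolp classical_sets.

Set Implicit Arguments.
Unset Strict Implicit.

Import GRing.Theory.
Local Open Scope ring_scope.

Section DiffAlgebra.
Variables (k : fieldType) (A : diffAlgType k).
Implicit Types (a b c p q w x y z : A) (S : set A).

Lemma dmulDr a b c : dmul a (b + c) = dmul a b + dmul a c.
Proof. by rewrite !(dmulC a) dmulDl. Qed.

Lemma dmul0r a : dmul a 0 = 0.
Proof. by have := dmulBr a 0 0; rewrite !subrr. Qed.

Lemma dmulCA a b c : dmul a (dmul b c) = dmul b (dmul a c).
Proof. by rewrite !dmulA (dmulC a). Qed.

Lemma derD a b : der (a + b) = der a + der b.
Proof. by rewrite -[a in LHS]scale1r der_linear scale1r. Qed.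

Lemma der0 : der (0 : A) = 0.
Proof. by have := derB (0 : A) 0; rewrite !subrr. Qed.

Definition annihilator S : set A :=
  [set w | forall s, S s -> dmul w s = 0]%classic.

(** In [(w s)' = w s' + w' s], both [w s] and [w s'] vanish. *)
Lemma annihilator_der S w :
  (forall s, S s -> S (der s)) -> annihilator S w -> annihilator S (der w).
Proof.
move=> Sder Sw s Ss; have := der_leibniz w s.
by rewrite Sw // Sw ?der0 ?add0r //; apply: Sder.
Qed.

Lemma annihilator_diff_ideal S :
  (forall s, S s -> S (der s)) -> diff_ideal (annihilator S).
Proof.
move=> Sder; split; first split.
- by move=> s _; rewrite dmulC dmul0r.
- by move=> c u v Su Sv s Ss; rewrite dmul_linearl Su ?Sv // scaler0 addr0.
- by move=> a x Sx s Ss; rewrite -dmulA Sx // dmul0r.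
- by move=> x; apply: annihilator_der.
Qed.

Hypothesis primeA : diff_prime A.

(** The annihilator of [S] and its own annihilator, which contains [s], are differential ideals with
    product zero. *)
Lemma annihilator_eq0 S s w : (forall t, S t -> S (der t)) -> S s -> s <> 0 ->
  annihilator S w -> w = 0.
Proof.
move=> Sder Ss s_neq0 Sw; apply: contrapT => w_neq0.
have annder v : annihilator S v -> annihilator S (der v).
  exact: annihilator_der.
apply: (@primeA (annihilator S) (annihilator (annihilator S))).
- exact: annihilator_diff_ideal.
- exact: annihilator_diff_ideal.
- by move=> S0; apply: w_neq0; rewrite S0 in Sw.
- move=> SS0; apply: s_neq0.
  have: annihilator (annihilator S) s by move=> t St; rewrite dmulC St.
  by rewrite SS0.
- apply/seteqP; split=> [_ [r [rP ->]]|_ ->].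
    by apply: big1_seq => -[u v] /andP[_] /rP[/= Su SSv]; rewrite dmulC SSv.
  by exists [::]; rewrite big_nil.
Qed.

(** Lacking a unit to put for [x], take [S] to be all of [A]. *)
Lemma dmull_eq0 w : (forall x, dmul x w = 0) -> w = 0.
Proof.
move=> w0; apply: contrapT => w_neq0; apply: (w_neq0).
by apply: (@annihilator_eq0 setT w) => // x _; rewrite dmulC w0.
Qed.

Hypothesis der_neq0 : exists a : A, der a <> 0.

Lemma dmul_derl_eq0 w : (forall x, dmul (der x) w = 0) -> w = 0.
Proof.
move=> w0; have [a a_neq0] := der_neq0.
apply: (@annihilator_eq0 (range der) (der a)) => //.
by move=> _ [x _ <-]; rewrite dmulC w0.
Qed.

Lemma second_order_relation_eq0 c p q : [pchar k] =i pred0 ->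
  (forall x, dmul x c = dmul (der x) p - dmul (der (der x)) q) -> q = 0.
Proof.
move=> char0 cE.
pose R x y := dmul (der x) (dmul (der y) q).
(* Expanding [cE] at [x y], the cross term of [(x y)''] gives [x y c = 2 x y c - 2 R x y]. *)
have RE x y : dmul x (dmul y c) = R x y + R x y.
  have cxy : dmul (dmul x y) c =
      dmul x (dmul y c) + dmul y (dmul x c) - (R x y + R x y).
    rewrite !cE !(der_leibniz, derD) !dmulDl !dmulBr -!dmulA -/(R x y).
    rewrite (dmulCA y (der x)) (dmulCA y (der (der x))).
    rewrite (addrC (R x y) (dmul _ _)) (addrACA (dmul _ _) (R x y)).
    by rewrite opprD addrA opprD addrACA.
  apply/(addrI (dmul x (dmul y c)))/eqP; rewrite -subr_eq.
  by rewrite {2}(dmulCA x) -cxy dmulA.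
have c_eq0 : c = 0.
  apply: dmull_eq0 => z; apply: dmull_eq0 => y; apply: dmull_eq0 => x.
  (* [R x] obeys the Leibniz rule, so [RE] at [x] and [y z] reads [x y z c = 2 x y z c]. *)
  have RM : R x (dmul y z) = dmul y (R x z) + dmul z (R x y).
    rewrite /R der_leibniz dmulDl dmulDr -!dmulA; congr (_ + _).
      by rewrite dmulCA.
    by rewrite (dmulCA (der y)) dmulCA.
  have := RE x (dmul y z); rewrite RM addrACA -(dmulDr y) -(dmulDr z) -!RE.
  rewrite -dmulA (dmulCA z x) (dmulCA z y) (dmulCA y x).
  by move/eqP; rewrite -subr_eq subrr eq_sym => /eqP.
(* Now [2 x' y' q = 0], and 2 is invertible in [k]. *)
apply: dmul_derl_eq0 => y; apply: dmul_derl_eq0 => x.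
have := RE x y; rewrite c_eq0 !dmul0r -/(R x y) -mulr2n -scaler_nat => /esym.
move/eqP; rewrite scaler_eq0 => /orP[|/eqP//].
by have := char0 2; rewrite !inE => /= ->.
Qed.

End DiffAlgebra.

(** The hypothesis [der_neq0] excludes a zero derivation on a nonzero [A], for which [Diff A] is
    abelian and so not prime. *)
Theorem theorem2 (k : fieldType) (A : diffAlgType k)
  (char0 : [pchar k] =i pred0)
  (der_neq0 : (exists a : A, a <> 0) -> exists a : A, der a <> 0)
  (primeA : diff_prime A) :
  lie_prime (Diff A).
Proof.
move=> I J [[I0 _] Ilie] [[J0 _] Jlie] I_neq0 J_neq0 IJ0.
have nonzero (S : set A) : S 0 -> S <> [set 0]%classic ->
    exists2 x : A, S x & x <> 0.
  move=> S0 S_neq0; apply: contrapT => nS; apply: S_neq0.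
  apply/seteqP; split=> [x Sx|_ ->] //; apply: contrapT => x_neq0.
  by apply: nS; exists x.
have [a0 Ia0 a0_neq0] := nonzero I I0 I_neq0.
have [b0 Jb0 b0_neq0] := nonzero J J0 J_neq0.
have der_nz : exists a : A, der a <> 0 by apply: der_neq0; exists a0.
have lie0 (a b : A) : I a -> J b -> Diff_lie a b = 0.
  move=> Ia Jb; have : span_op lie I J (Diff_lie a b).
    exists [:: (a, b)]; split; last by rewrite big_seq1.
    by move=> u; rewrite inE => /eqP->.
  by rewrite IJ0.
have ab0 (a b : A) : I a -> J b -> dmul a b = 0.
  move=> Ia Jb.
  (* These are the coefficients of [x] and [x'] in [[a, [x, b]] = 0], with [q = a b] that of
     [x'']. *)
  apply: (@second_order_relation_eq0 _ _ primeA der_nz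
    (dmul (der a) (der b) - dmul a (der (der b))) (dmul (der a) b)) => // x.
  have := lie0 a _ Ia (Jlie x b Jb); rewrite [lie _ _]/(Diff_lie x b).
  rewrite Diff_lie_lie -!dmulA (dmulCA a x) (dmulCA a (der (der x))).
  rewrite (dmulCA (der a) x) (dmulCA (der a) (der x)) => /eqP.
  rewrite subr_eq0 eq_sym subr_eq dmulBr => /eqP ->.
  by rewrite addrAC [_ - _ - _]addrAC subrr sub0r addrC.
have abn n (a b : A) : I a -> J b -> dmul a (iter n der b) = 0.
  elim: n a b => [|n IHn] a b Ia Jb; first exact: ab0.
  (* Apply the induction hypothesis to [[x, a] = x a' - x' a], which lies in [I], then cancel
     [x]. *)
  have a'b0 : dmul (der a) (iter n der b) = 0.
    apply: (dmull_eq0 primeA) => x; have := IHn _ b (Ilie x a Ia) Jb.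
    rewrite [lie _ _]/(Diff_lie x a) /Diff_lie dmulC dmulBr.
    by rewrite !(dmulC (iter _ _ _)) -!dmulA (IHn a b) // dmul0r subr0.
  by have := der_leibniz a (iter n der b); rewrite IHn // der0 a'b0 addr0.
apply: a0_neq0.
apply: (@annihilator_eq0 _ _ primeA
  [set s | exists n, exists2 b : A, J b & s = iter n der b]%classic b0) => //.
- by move=> _ [n [b Jb ->]]; exists n.+1, b.
- by exists 0, b0.
- by move=> _ [n [b Jb ->]]; apply: abn.
Qed.
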